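(* Let $T\colon\mathscr{D}(T)\to\mathscr{B}$ be a closed linear operator on a Banach space $\mathscr{B}$, $P$ a bounded projection of $\mathscr{B}$ onto a closed subspace $\mathscr{B}_0$, and $Q=1-P$. Let $s$ and $f$ be, respectively, the Stieltjes function and the FR-function of $P$ with respect to $T$. Then, if $z^{-1}\in\varrho(T)$, $$ z^{-1}\in\varpi(QT)\iff s(z) \text{ has an inverse } s(z)^{-1}\colon\mathscr{B}_0\to\mathscr{B}_0 \text{ everywhere defined on } \mathscr{B}_0, $$ $$ z^{-1}\in\varrho(QT)\iff s(z) \text{ has an inverse } s(z)^{-1}\in\mathfrak{B}(\mathscr{B}_0). $$ Besides, $f$ and $s$ are related by $$ s(z)^{-1}=1_0-zf(z),\qquad z^{-1}\in\varrho(T)\cap\varpi(QT), $$ where $1_0$ is the identity on $\mathscr{B}_0$.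
   Context: Linear operators $T\colon\mathscr{D}(T)\to\mathscr{B}$ need not be bounded, everywhere defined or densely defined; products and sums have their natural domains (so $QT$ has domain $\mathscr{D}(T)$). For a Banach space $X$, $\mathfrak{B}(X)$ denotes the bounded linear operators defined on all of $X$. For a linear operator $S\colon\mathscr{D}(S)\to X$, $\varpi(S)=\{\lambda\in\mathbb{C}:\ker(\lambda-S)=\{0\},\ \mathrm{Range}(\lambda-S)=X\}$ and $\varrho(S)=\{\lambda\in\mathbb{C}:(\lambda-S)^{-1}\text{ exists and belongs to }\mathfrak{B}(X)\}$. A bounded projection onto $\mathscr{B}_0$ is a bounded linear $P\colon\mathscr{B}\to\mathscr{B}$ with $P^2=P$ and range $\mathscr{B}_0$. The Stieltjes function of $P$ with respect to the closed operator $T$ is $s(z)=P(1-zT)^{-1}P$, for $z^{-1}\in\varrho(T)$, regarded as an operator on $\mathscr{B}_0$. The FR-function (first return function) of $P$ with respect to $T$ is $f(z)=PT(1-zQT)^{-1}P$, for $z^{-1}\in\varpi(QT)$, regarded as an operator on $\mathscr{B}_0$. Here $z\in\mathbb{C}\setminus\{0\}$. *)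

(* Defs.v *)
From mathcomp Require Import all_boot all_order all_algebra.
From mathcomp Require Import complex.
From mathcomp Require Import all_classical all_reals all_analysis.
Set Implicit Arguments.
Unset Strict Implicit.
Unset Printing Implicit Defensive.
Import GRing.Theory Num.Theory.
Import numFieldNormedType.Exports.
Local Open Scope classical_set_scope.
Local Open Scope ring_scope.

(* A partially defined operator in X is represented by its graph, a set of
   pairs: the domain of S is S.`1, its range is S.`2, the composite "A after B"
   is (A \; B)%relation (so its domain consists of the x in B.`1 with B x in
   A.`1), and (S^-1)%relation is the inverse relation, which is an operator
   exactly when S is one-to-one.  Equality of operators, including equality of
   their domains, is equality of graphs. *)

Section Operators.
Context {K : numFieldType} {X : normedModType K}.
Implicit Types (S A B : set (X * X)) (E : set X) (l : K).

Definition linear_operator S :=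
  submod_closed [in S] /\ is_fun (fun x y => S (x, y)).

Definition closed_operator S := linear_operator S /\ closed S.

Definition op_fun (f : X -> X) : set (X * X) := [set xy | xy.2 = f xy.1].

Definition op_id E : set (X * X) := [set xy | E xy.1 /\ xy.2 = xy.1].

Definition op_scale l S : set (X * X) :=
  [set xy | exists2 y, S (xy.1, y) & xy.2 = l *: y].

Definition op_sub A B : set (X * X) :=
  [set xy | exists a b, [/\ A (xy.1, a), B (xy.1, b) & xy.2 = a - b]].

(* S considered in the subspace E *)
Definition op_on E S : set (X * X) := S `&` (E `*` E).

Definition op_ker S : set X := [set x | S (x, 0)].

(* S is a linear operator from E to E, defined on all of E *)
Definition everywhere_defined E S :=
  [/\ linear_operator S, S.`1 = E & S.`2 `<=` E].

(* S belongs to B(E), the subspace E carrying the norm of X *)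
Definition bounded_operator E S :=
  everywhere_defined E S /\
  exists M : K, forall x y, S (x, y) -> `|y| <= M * `|x|.

(* the operator l - S *)
Definition op_shift l S := op_sub (op_scale l (op_id setT)) S.

Definition varpi S : set K :=
  [set l | op_ker (op_shift l S) = [set 0] /\ (op_shift l S).`2 = setT].

Definition varrho S : set K :=
  [set l | bounded_operator setT ((op_shift l S)^-1)%relation].

Definition closed_subspace E := submod_closed [in E] /\ closed E.

Definition bounded_projection E (P : {linear X -> X}) :=
  [/\ exists M : K, forall x, `|P x| <= M * `|x|,
      forall x, P (P x) = P x & range P = E].

Section FirstReturn.
Variables (B0 : set X) (T : set (X * X)) (P : {linear X -> X}).

Definition compl_proj : X -> X := fun x => x - P x.

Definition op_QT : set (X * X) := (op_fun compl_proj \; T)%relation.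

(* the operator (1 - z S)^-1 *)
Definition op_resolv (z : K) S : set (X * X) :=
  ((op_sub (op_id setT) (op_scale z S))^-1)%relation.

Definition stieltjes (z : K) : set (X * X) :=
  op_on B0 (op_fun P \; (op_resolv z T \; op_fun P))%relation.

Definition first_return (z : K) : set (X * X) :=
  op_on B0
    (op_fun P \; (T \; (op_resolv z op_QT \; op_fun P)))%relation.

End FirstReturn.

End Operators.

(* Main.v *)
From HB Require Import structures.
Require Import Defs.
From mathcomp Require Import all_boot all_order all_algebra.
From mathcomp Require Import complex.
From mathcomp Require Import all_classical all_reals all_analysis.
Import Order.TTheory GRing.Theory Num.Theory.
Import numFieldNormedType.Exports.
Local Open Scope classical_set_scope.
Local Open Scope ring_scope.

(** Write Q = 1 - P and let r = (1 - zT)^-1, a bounded operator defined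
    everywhere since z^-1 is in the resolvent set of T.  Substituting x = r u in
    x - z QT x, and using x - z T x = u, gives

      (1 - z QT) (r u) = Q u + P r u,

    so solving (1 - z QT) x = w amounts to solving Q u + P r u = w for u.  In
    the decomposition of the space into the ranges of P and Q the operator
    u |-> Q u + P r u is triangular: it is the identity on the Q-part and
    P r P = s(z) on the P-part.  Hence 1 - z QT is a bijection from its domain
    onto the whole space exactly when s(z) is a bijection of B0.  Explicitly,
    with g = s(z)^-1 P,

      (1 - z QT)^-1 w = r (g (w - r Q w) + Q w)    (op_resolv_QT_block),

    which is bounded as soon as s(z)^-1 is.

    The converse for boundedness is not algebraic: for w in B0, a bound on
    (1 - z QT)^-1 w = r u does not bound u, because 1 - zT may be unbounded.
    But s(z) is bounded on the closed subspace B0, so s(z)^-1 has a closed graph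
    and is bounded as soon as it is everywhere defined
    (stieltjes_inv_bounded), by the closed graph theorem.  That theorem holds
    over every Archimedean number field, the complex numbers being one: since
    the sublevel sets of |f| cover the space, one of them is dense in a ball
    by Baire's argument, and successive approximation passes from the dense
    subset to all vectors.

    For the last formula let y be in B0 and w = s(z)^-1 y.  Then x = r w solves
    (1 - z QT) x = y, and since P x = y and w = x - z T x, applying P gives
    w = y - z P T x = y - z f(z) y. *)

(** * Closed graph theorem over an Archimedean number field *)

Section ClosedGraph.
Context {K : numFieldType} (archiK : forall x : K, exists n : nat, `|x| < n%:R).

(** Since r n is at most r 0 / 2^n, the Archimedean property makes it small. *)
Lemma halving_small (r : nat -> K) :
  (forall n, 0 <= r n) -> (forall n, r n.+1 <= r n / 2) ->
  forall e, 0 < e -> exists n, r n < e.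
Proof.
move=> r0 r_half e e0.
have rn n : r n * (2 ^ n)%:R <= r 0%N.
  elim: n => [|n]; first by rewrite mulr1.
  apply: le_trans; rewrite expnS natrM mulrA ler_wpM2r ?ler0n//.
  by rewrite -ler_pdivlMr ?ltr0n.
have [n] := archiK (r 0%N / e).
rewrite ger0_norm ?divr_ge0 ?(ltW e0)// ltr_pdivrMr// => r0n.
exists n; have p0 : 0 < (2 ^ n)%:R :> K by rewrite ltr0n expn_gt0.
rewrite -(ltr_pM2r p0) (le_lt_trans (rn n))// (lt_le_trans r0n)// mulrC.
by rewrite ler_pM2l// ler_nat ltnW// ltn_expl.
Qed.

(** Since r n is at least the sum of the r k / 2 over k >= n, the sequence stays
    within r n of its n-th term.  This serves both the nested balls of the
    Baire argument and the successive approximations of the closed graph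
    theorem. *)
Lemma halving_cvg (X : completeNormedModType K) (v : nat -> X) (r : nat -> K) :
  (forall n, `|v n - v n.+1| <= r n / 2) -> (forall n, r n.+1 <= r n / 2) ->
  exists2 l, v @ \oo --> l & forall n, `|v n - l| <= r n.
Proof.
move=> vr r_half.
have r0 n : 0 <= r n.
  by rewrite -(pmulr_lge0 _ (_ : 0 < 2^-1)) ?invr_gt0// (le_trans _ (vr n)).
have dist n m : `|v n - v (m + n)%N| <= r n.
  elim: m n => [|m IH] n; first by rewrite subrr normr0.
  rewrite (le_trans (ler_distD (v n.+1) _ _))// addSnnS.
  by rewrite [leRHS](splitr (r n)) lerD// (le_trans (IH n.+1)).
have small := halving_small _ r0 r_half.
have /cvg_ex[l vl] : cvg (v @ \oo).
  apply: cauchy_cvg; apply: cauchy_exP => e e0.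
  have [n rn] := small e e0; exists (v n), n => // m /= nm.
  by rewrite -ball_normE /ball_/= -(subnK nm) (le_lt_trans (dist _ _)).
exists l => // n; apply/ler_addgt0Pr => e e0.
have /cvgrPdist_le/(_ e e0)[N _ vN] := vl.
rewrite (le_trans (ler_distD (v (N + n)%N) _ _))// lerD// distrC.
by apply: vN; rewrite /= leq_addr.
Qed.

Lemma pos_lower_bound (a b : K) : 0 < a -> 0 < b ->
  exists c, [/\ 0 < c, c <= a & c <= b].
Proof.
move=> a0 b0; have /orP[ab|ba] := real_leVge (gtr0_real a0) (gtr0_real b0).
  by exists a.
by exists b.
Qed.

(** Baire's argument.  If every F n were nowhere dense, one could choose nested
    balls, the one with index n.+1 missing F n; their common point would lie in
    no F n. *)
Lemma countable_cover_somewhere_dense (X : completeNormedModType K)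
    (F : nat -> set X) : (forall x, exists n, F n x) ->
  exists n c d, 0 < d /\ forall x, `|c - x| <= d ->
    forall e, 0 < e -> exists2 y, F n y & `|x - y| < e.
Proof.
move=> coverF; apply: contrapT => nowhere.
have step (p : nat * (X * K)) : exists q : X * K, 0 < p.2.2 ->
    [/\ 0 < q.2, q.2 <= p.2.2 / 2, `|p.2.1 - q.1| <= p.2.2 / 2 &
        forall y, `|q.1 - y| <= q.2 -> ~ F p.1 y].
  case: p => n [c d] /=; apply: contrapT => stuck; apply: nowhere.
  have [d0|d0] := pselect (0 < d); last by case: stuck; exists (c, d).
  exists n, c, (d / 2); split=> [|x cx e e0]; first by rewrite divr_gt0.
  apply: contrapT => far; apply: stuck.
  have d2 : 0 < d / 2 by rewrite divr_gt0.
  have e2 : 0 < e / 2 by rewrite divr_gt0.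
  have [q [q0 qd qe]] := pos_lower_bound _ _ d2 e2.
  (* q <= e / 2, so the closed ball of radius q lies in the open one of radius
     e, which misses F n. *)
  exists (x, q) => _; split=> // y /= xy Fy; apply: far; exists y => //.
  by rewrite (le_lt_trans xy)// (le_lt_trans qe)// gtr_pMr// invf_lt1 ?ltr1n.
have [next nextP] := choice step.
pose fix cd n : X * K := if n is m.+1 then next (m, cd m) else (0, 1).
have cd0 n : 0 < (cd n).2.
  by elim: n => [|n IH] /=; [exact: ltr01|case: (nextP (n, cd n) IH)].
have cdP n := nextP (n, cd n) (cd0 n).
have [||l _ cl] := @halving_cvg X (fun n => (cd n).1) (fun n => (cd n).2).
- by move=> n; case: (cdP n).
- by move=> n; case: (cdP n).
have [n Fnl] := coverF l.
by case: (cdP n) => _ _ _ /(_ l (cl n.+1)).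
Qed.

(** By linearity, a limit point of the graph can be translated to one above 0,
    so the graph is closed as soon as f has no other limit than 0 along
    sequences tending to 0. *)
Theorem closed_graph (X : completeNormedModType K) (f : {linear X -> X}) :
  (forall (v : nat -> X) y, v @ \oo --> 0 -> f \o v @ \oo --> y -> y = 0) ->
  exists M : K, forall x, `|f x| <= M * `|x|.
Proof.
move=> sep.
have [|n [c [d [d0 dense]]]] :=
    @countable_cover_somewhere_dense X (fun n => [set x | `|f x| <= n%:R]).
  by move=> x; have [n] := archiK `|f x|; rewrite normr_id => /ltW; exists n.
pose C : K := n%:R *+ 2 / d.
have C0 : 0 <= C by rewrite divr_ge0 ?mulrn_wge0 ?ltW.
(* The sublevel set n is dense in the ball of centre c and radius d.  Both c and
   c + k x, with k = d / |x|, are approximated in it up to d / 4; the difference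
   of the approximations, divided by k, approximates x up to |x| / 2. *)
have approx x : exists u, `|x - u| <= `|x| / 2 /\ `|f u| <= C * `|x|.
  have [->|x0] := eqVneq x 0.
    by exists 0; rewrite subrr linear0 normr0 mul0r mulr0.
  have nx0 : 0 < `|x| by rewrite normr_gt0.
  pose k := d / `|x|; have k0 : 0 < k by rewrite divr_gt0.
  have e0 : 0 < d / 4 by rewrite divr_gt0.
  have [|a /= fa xa] := dense (c + k *: x) _ _ e0.
    by rewrite opprD addrA subrr sub0r normrN normrZ gtr0_norm// divfK ?gt_eqF.
  have [|b /= fb xb] := dense c _ _ e0; first by rewrite subrr normr0 ltW.
  exists (k^-1 *: (a - b)); split.
    have -> : x - k^-1 *: (a - b) = k^-1 *: ((c + k *: x - a) - (c - b)).
      rewrite (_ : c + k *: x - a - (c - b) = k *: x - (a - b)).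
        by rewrite [RHS]scalerBr scalerA mulVf ?gt_eqF// scale1r.
      rewrite !opprB [c + _]addrC -!addrA; congr (_ + _).
      by rewrite addrC -addrA subrK addrC.
    rewrite normrZ gtr0_norm ?invr_gt0// ler_pdivrMl//.
    rewrite (le_trans (ler_normB _ _))// (le_trans (ltW (ltrD xa xb)))//.
    rewrite /k mulrA divfK ?gt_eqF// -[4]/(2 * 2)%:R natrM invfM mulrA.
    by rewrite -splitr.
  rewrite linearZ/= normrZ gtr0_norm ?invr_gt0// ler_pdivrMl//.
  rewrite mulrCA /k divfK ?gt_eqF// /C divfK ?gt_eqF// linearB/=.
  by rewrite (le_trans (ler_normB _ _))// mulr2n lerD.
have [u uP] := choice approx.
exists (C * 2) => x.
(* w m is the error after m approximations of x.  It tends to 0 while f (w m)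
   converges, necessarily to 0, and f x = f (w 0) - lim f (w m) is bounded by
   the sum of the |f (u (w m))|. *)
pose fix w n := if n is m.+1 then w m - u (w m) else x.
have wS m : `|w m.+1| <= `|w m| / 2 by case: (uP (w m)).
have fwS m : `|f (w m) - f (w m.+1)| <= C * 2 * `|w m| / 2.
  rewrite -linearB/= opprB addrC subrK.
  by rewrite mulrAC mulrK ?unitfE//; case: (uP (w m)).
have w0 : w @ \oo --> 0.
  apply/cvgrPdist_le => e e0.
  have [//|m wm] := halving_small (fun m => `|w m|) _ wS _ e0.
  exists m => // j /= mj; rewrite sub0r normrN (le_trans _ (ltW wm))//.
  rewrite -(subnK mj); elim: (j - m)%N => //= i IH.
  by rewrite (le_trans (wS _))// (le_trans _ IH)// ler_piMr// invf_le1 ?ler1n.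
have [|y fwy fxy] := halving_cvg X _ (fun m => C * 2 * `|w m|) fwS.
  move=> m; rewrite -[leRHS]mulrA.
  by apply: ler_wpM2l; [exact: mulr_ge0|exact: wS].
by have := fxy 0%N; rewrite (sep _ _ w0 fwy) subr0.
Qed.

End ClosedGraph.

Lemma complex_archimedean (R : realType) (x : R[i]) :
  exists n : nat, `|x| < n%:R.
Proof.
case: x => a b; rewrite normc_def.
set m := Num.sqrt _; exists (Num.truncn m).+1.
by rewrite -(rmorph_nat (@real_complex R)) ltcR truncnS_gt.
Qed.

(** * Bounded maps *)

Section BoundedMaps.
Context {K : numFieldType} {X : normedModType K}.

Definition bounded_map (f : X -> X) :=
  exists M : K, forall x, `|f x| <= M * `|x|.

(** A bound M need not be nonnegative, nor even real, when the space is 0. *)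
Lemma bounded_map_ge0 (f : X -> X) : bounded_map f ->
  exists2 M : K, 0 <= M & forall x, `|f x| <= M * `|x|.
Proof.
move=> [M fM]; exists `|M| => // x.
have Mx : 0 <= M * `|x| := le_trans (normr_ge0 _) (fM x).
by rewrite (le_trans (fM x))// -(ger0_norm Mx) normrM normr_id.
Qed.

Lemma bounded_map_id : bounded_map id.
Proof. by exists 1 => x; rewrite mul1r. Qed.

Lemma bounded_mapD (f g : X -> X) :
  bounded_map f -> bounded_map g -> bounded_map (fun x => f x + g x).
Proof.
move=> [M fM] [N gN]; exists (M + N) => x.
by rewrite mulrDl (le_trans (ler_normD _ _))// lerD.
Qed.

Lemma bounded_mapB (f g : X -> X) :
  bounded_map f -> bounded_map g -> bounded_map (fun x => f x - g x).
Proof.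
move=> bf [N gN]; apply: bounded_mapD => //.
by exists N => x; rewrite normrN.
Qed.

Lemma bounded_map_comp (f g : X -> X) :
  bounded_map f -> bounded_map g -> bounded_map (fun x => f (g x)).
Proof.
move=> /bounded_map_ge0[M M0 fM] [N gN]; exists (M * N) => x.
by rewrite (le_trans (fM _))// -mulrA ler_wpM2l.
Qed.

Lemma bounded_map_cvg (f : {linear X -> X}) : bounded_map f ->
  forall (v : nat -> X) l, v @ \oo --> l -> f \o v @ \oo --> f l.
Proof.
move=> /bounded_map_ge0[M M0 fM] v l vl; apply: continuous_cvg vl.
apply: bounded_linear_continuous; apply/ex_bound; exists M.
apply/nbhs_norm0P; exists 1 => //= x /ltW x1 /=.
by rewrite (le_trans (fM x))// ler_piMr.
Qed.

End BoundedMaps.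

(** * Operators as graphs *)

Section Operators.
Context {K : numFieldType} {X : normedModType K}.
Implicit Types (S A : set (X * X)) (E : set X) (z : K).

Lemma subspaceP (V : lmodType K) (S : set V) :
  submod_closed [in S] <-> S 0 /\ forall a u v, S u -> S v -> S (a *: u + v).
Proof.
split=> [[S0 SD]|[S0 SD]]; split.
- by rewrite inE in S0.
- by move=> a u v Su Sv; have := SD a u v; rewrite !inE; apply.
- by rewrite inE.
- by move=> a u v; rewrite !inE; apply: SD.
Qed.

(** Turns the graph of an operator defined on the whole space into a function,
    so that the identities below can be proved by rewriting. *)
Lemma everywhere_defined_linear S : everywhere_defined setT S ->
  exists f : {linear X -> X}, forall x y, S (x, y) <-> y = f x.
Proof.
move=> [[/subspaceP[_ SD] Sfun] Sdom _].
have total x : exists y, S (x, y) by have : [set: X] x by []; rewrite -Sdom.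
have [f fS] := choice total.
have fE x y : S (x, y) <-> y = f x.
  by split=> [Sxy|->//]; apply: Sfun Sxy (fS x).
have lf : linear f.
  by move=> a u v; symmetry; apply/fE; exact: (SD a _ _ (fS u) (fS v)).
pose L := GRing.isLinear.Build K X X *:%R f lf.
by exists (HB.pack f L : {linear X -> X}).
Qed.

Lemma op_shiftE (l : K) S x y :
  op_shift l S (x, y) <-> exists2 t, S (x, t) & y = l *: x - t.
Proof.
split=> [[a [t [[b [/= _ ->] ->] Sxt /= ->]]]|[t Sxt ->]]; first by exists t.
by exists (l *: x), t; split=> //; exists x.
Qed.

Lemma op_resolvE z S w x :
  op_resolv z S (w, x) <-> exists2 t, S (x, t) & w = x - z *: t.
Proof.
split=> [[a [b [[_ /= ->] [t /= Sxt ->] ->]]]|[t Sxt ->]]; first by exists t.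
by exists x, (z *: t); split=> //; exists t.
Qed.

Lemma op_resolv_shift z S w x : z != 0 ->
  op_resolv z S (w, x) <-> op_shift z^-1 S (x, z^-1 *: w).
Proof.
move=> z0; rewrite op_resolvE op_shiftE; split=> -[t Sxt wE]; exists t => //.
  by rewrite wE scalerBr scalerA mulVf// scale1r.
by rewrite -[w]scale1r -(mulfV z0) -scalerA wE scalerBr scalerA mulfV// scale1r.
Qed.

Lemma op_resolv_subspace z S : linear_operator S ->
  submod_closed [in op_resolv z S].
Proof.
move=> [/subspaceP[S0 SD] _]; apply/subspaceP; split.
  by apply/op_resolvE; exists 0 => //; rewrite scaler0 subr0.
move=> a [w x] [w' x'] /op_resolvE[t St ->] /op_resolvE[t' St' ->].
apply/op_resolvE; exists (a *: t + t'); first exact: (SD a _ _ St St').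
by rewrite /= scalerBr scalerDr opprD addrACA !scalerA mulrC.
Qed.

Lemma op_resolv_inj z S w w' x : linear_operator S ->
  op_resolv z S (w, x) -> op_resolv z S (w', x) -> w = w'.
Proof.
move=> [_ Sfun] /op_resolvE[t St ->] /op_resolvE[t' St' ->].
by rewrite (Sfun x t t').
Qed.

(** Since z (z^-1 - S) = 1 - z S, both spectral sets can be read off
    (1 - z S)^-1, the operator in terms of which s and f are defined. *)
Lemma varpi_resolv z S : z != 0 -> linear_operator S ->
  varpi S z^-1 <-> everywhere_defined setT (op_resolv z S).
Proof.
move=> z0 linS; have subR := op_resolv_subspace z S linS.
have /subspaceP[R0 RD] := subR.
split=> [[ker ran]|[[_ Rfun] Rdom _]].
  split=> //; first split=> //.
  - move=> w x x' Rx Rx'; apply/eqP; rewrite -subr_eq0; apply/eqP.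
    suff : op_ker (op_shift z^-1 S) (x - x') by rewrite ker.
    have := RD (-1) _ _ Rx' Rx.
    have -> : -1 *: (w, x') + (w, x) = (0, x - x').
      by congr (_, _); rewrite /= scaleN1r ?addNr// addrC.
    by move=> /(op_resolv_shift _ _ _ _ z0); rewrite scaler0.
  - rewrite eqEsubset; split=> // w _.
    have : [set: X] (z^-1 *: w) by []; rewrite -ran => -[x Rx].
    by exists x; apply/(op_resolv_shift _ _ _ _ z0).
split; rewrite eqEsubset; split=> //.
- move=> x kx; apply: (Rfun 0 x 0 _ R0).
  by apply/(op_resolv_shift _ _ _ _ z0); rewrite scaler0.
- by move=> _ ->; have /(op_resolv_shift _ _ _ _ z0) := R0; rewrite scaler0.
- move=> y _; have : [set: X] (z *: y) by []; rewrite -Rdom => -[x Rx].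
  exists x; have /(op_resolv_shift _ _ _ _ z0) := Rx.
  by rewrite scalerA mulVf// scale1r.
Qed.

Lemma bounded_operator_rescale (c : K) A A' : c != 0 ->
  (forall y x, A' (y, x) <-> A (c *: y, x)) ->
  bounded_operator setT A -> bounded_operator setT A'.
Proof.
move=> c0 AA' [edA [M AM]]; have [f fA] := everywhere_defined_linear A edA.
have fA' y x : A' (y, x) <-> x = f (c *: y) by rewrite AA'.
split; last first.
  exists (M * `|c|) => y x /AA'/AM; by rewrite normrZ mulrA.
split=> //.
- split; last by move=> y x x' /fA' -> /fA' ->.
  apply/subspaceP; split; first by apply/fA'; rewrite scaler0 linear0.
  move=> a [y x] [y' x'] /fA' -> /fA' ->; apply/fA'.
  by rewrite scalerDr scalerA mulrC -scalerA linearP.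
- by rewrite eqEsubset; split=> // y _; exists (f (c *: y)); apply/fA'.
Qed.

Lemma varrho_resolv z S : z != 0 ->
  varrho S z^-1 <-> bounded_operator setT (op_resolv z S).
Proof.
move=> z0; split; apply: bounded_operator_rescale.
- exact: (invr_neq0 z0).
- by move=> y x; apply: op_resolv_shift.
- exact: z0.
- move=> y x /=; rewrite -/(op_shift _ _).
  by rewrite (op_resolv_shift _ _ _ _ z0) scalerA mulVf// scale1r.
Qed.

End Operators.

(** * Stieltjes and first return functions *)

(** Throughout, z is such that r = (1 - zT)^-1 is an everywhere defined linear
    map. *)
Section FirstReturn.
Context {K : numFieldType} {X : completeNormedModType K}.
Context (T : set (X * X)) (B0 : set X) (P : {linear X -> X}) (z : K).
Context (linT : linear_operator T) (subB0 : closed_subspace B0)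
  (projP : bounded_projection B0 P).
Context (r : {linear X -> X}).
Context (rE : forall w x, op_resolv z T (w, x) <-> x = r w).

Let PP x : P (P x) = P x. Proof. by case: projP. Qed.
Let bP : bounded_map P. Proof. by case: projP. Qed.

Let B0P x : B0 x <-> P x = x.
Proof.
case: projP => _ _ <-; split=> [[y _ <-]|<-]; first exact: PP.
by exists x.
Qed.

Let B0_P x : B0 (P x). Proof. by apply/B0P; rewrite PP. Qed.

Let r_inj : injective r.
Proof.
by move=> u v ruv; apply: (op_resolv_inj z T _ _ (r u) linT); apply/rE.
Qed.

Lemma op_QTE x q : op_QT T P (x, q) <-> exists2 t, T (x, t) & q = t - P t.
Proof. by split=> -[t Tt qE]; exists t. Qed.

Lemma op_QT_linear : linear_operator (op_QT T P).
Proof.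
case: linT => /subspaceP[T0 TD] Tfun; split; last first.
  by move=> x q q' /op_QTE[t Tt ->] /op_QTE[t' Tt' ->]; rewrite (Tfun x t t').
apply/subspaceP; split.
  by apply/op_QTE; exists 0; [exact: T0|rewrite linear0 subr0].
move=> a [x q] [x' q'] /op_QTE[t Tt ->] /op_QTE[t' Tt' ->]; apply/op_QTE.
exists (a *: t + t'); first exact: (TD a _ _ Tt Tt').
by rewrite /= linearP scalerBr opprD addrACA.
Qed.

(** The identity (1 - z QT) (r u) = (1 - P) u + P r u: with t = T x and
    u = x - z t, one has x - z (t - P t) = u + P (z t) = u + P (x - u). *)
Lemma op_resolv_QT w x : op_resolv z (op_QT T P) (w, x) <->
  exists2 u, x = r u & w = u - P u + P (r u).
Proof.
have split_t t : x - z *: (t - P t) = x - z *: t - P (x - z *: t) + P x.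
  rewrite [P (_ - _)]linearB [P (_ *: _)]linearZ/= opprB -[RHS]addrA subrK.
  by rewrite scalerBr opprB addrA addrAC.
split=> [/op_resolvE[q /op_QTE[t Tt ->] ->]|[u xE ->]].
  have xE : x = r (x - z *: t) by apply/rE/op_resolvE; exists t.
  by exists (x - z *: t); rewrite -?xE.
have /rE/op_resolvE[t Tt uE] := xE.
apply/op_resolvE; exists (t - P t); first by apply/op_QTE; exists t.
by rewrite -xE split_t -uE.
Qed.

(** Applying 1 - P to the equation kills y and P (r u), which leaves
    u = P u. *)
Lemma block_solution y u : B0 y -> y = u - P u + P (r u) ->
  B0 u /\ y = P (r u).
Proof.
move=> /B0P Py yE.
have yPru : y = P (r u).
  by rewrite -Py yE linearD linearB/= !PP subrr add0r.
split=> //; apply/B0P/esym/eqP; rewrite -subr_eq0.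
by rewrite -(inj_eq (addIr (P (r u)))) add0r -yE -yPru.
Qed.

Lemma stieltjesE w y : stieltjes B0 T P z (w, y) <->
  [/\ B0 w, B0 y & y = P (r w)].
Proof.
split=> [[[x [u /= uE /rE xE] yE] [B0w B0y]]|[B0w B0y yE]].
  have {}uE : u = P w := uE; have {}yE : y = P x := yE.
  by split=> //; rewrite yE xE uE; move/B0P: B0w => ->.
split=> //; exists (r w) => //; exists (P w) => //.
by apply/rE; move/B0P: B0w => ->.
Qed.

Lemma stieltjes_inv_subspace :
  submod_closed [in ((stieltjes B0 T P z)^-1)%relation].
Proof.
case: subB0 => /subspaceP[B00 B0D] _; apply/subspaceP; split.
  by apply/stieltjesE; rewrite !linear0.
move=> a [y w] [y' w'] /stieltjesE[B0w B0y /= yE] /stieltjesE[B0w' B0y' /= yE'].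
apply/stieltjesE; split; [exact: B0D|exact: B0D|].
by rewrite /= !linearP -yE -yE'.
Qed.

(** For y in B0 the solutions of (1 - z QT) x = y are the r u with u in B0 and
    s(z) u = y, so unique solvability passes to s(z). *)
Lemma stieltjes_inv_everywhere :
  everywhere_defined setT (op_resolv z (op_QT T P)) ->
  everywhere_defined B0 ((stieltjes B0 T P z)^-1)%relation.
Proof.
move=> [[_ Rfun] Rdom _]; split.
- split; first exact: stieltjes_inv_subspace.
  move=> y w w' /stieltjesE[B0w _ yE] /stieltjesE[B0w' _ yE'].
  have solves v : B0 v -> y = P (r v) -> op_resolv z (op_QT T P) (y, r v).
    move=> /B0P Pv ->; apply/op_resolv_QT; exists v => //.
    by rewrite Pv subrr add0r.
  by apply: r_inj; apply: Rfun; exact: solves.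
- rewrite eqEsubset; split=> [y [w /stieltjesE[]//]|y B0y].
  have : [set: X] y by []; rewrite -Rdom => -[_ /op_resolv_QT[u _ yE]].
  have [B0u yPru] := block_solution y u B0y yE.
  by exists u; apply/stieltjesE.
- by move=> w [y /stieltjesE[]].
Qed.

(** Precomposing s(z)^-1 with P extends it from B0 to the whole space. *)
Lemma stieltjes_inv_linear :
  everywhere_defined B0 ((stieltjes B0 T P z)^-1)%relation ->
  exists g : {linear X -> X},
    forall y w, stieltjes B0 T P z (w, P y) <-> w = g y.
Proof.
move=> [[/subspaceP[S0 SD] Sfun] Sdom _].
have [|g gE] := @everywhere_defined_linear _ _
  [set yw | stieltjes B0 T P z (yw.2, P yw.1)]; last by exists g.
split=> //.
- split; last by move=> y; exact: (Sfun (P y)).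
  apply/subspaceP; split=> /=; first by rewrite linear0; exact: S0.
  move=> a [y w] [y' w'] /= Su Sv; rewrite linearP.
  exact: (SD a (P y, w) (P y', w')).
- rewrite eqEsubset; split=> // y _.
  have [w Sw] : (((stieltjes B0 T P z)^-1)%relation).`1 (P y) by rewrite Sdom.
  by exists w.
Qed.

(** Triangular solution of u - P u + P r u = w: the Q-part of u is q = w - P w,
    and its P-part v satisfies P r v = P w - P r q, that is
    v = s(z)^-1 P (w - r q). *)
Lemma op_resolv_QT_block (g : {linear X -> X}) :
  (forall y w, stieltjes B0 T P z (w, P y) <-> w = g y) ->
  forall w x, op_resolv z (op_QT T P) (w, x) <->
    x = r (g (w - r (w - P w)) + (w - P w)).
Proof.
move=> gE w x; split=> [/op_resolv_QT[u -> ->]|->].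
  have PwE : P (u - P u + P (r u)) = P (r u).
    by rewrite linearD linearB/= !PP subrr add0r.
  rewrite PwE addrK; congr (r _).
  rewrite -[LHS](subrK (P u)) addrC; congr (_ + _).
  apply/gE/stieltjesE; split=> //.
  by rewrite linearB/= PwE -linearB/= -linearB/= opprB addrC subrK.
set q := w - P w; set v := g (w - r q).
have /stieltjesE[/B0P Pv _ rv] : stieltjes B0 T P z (v, P (w - r q)).
  exact/gE.
have Pq : P q = 0 by rewrite linearB/= PP subrr.
apply/op_resolv_QT; exists (v + q) => //.
rewrite (linearD P v q) Pv Pq addr0 (linearD r v q) (linearD P (r v)) -rv.
by rewrite (linearB P w) subrK [v + q]addrC addrK subrK.
Qed.

Lemma op_resolv_QT_everywhere (g : {linear X -> X}) :
  (forall y w, stieltjes B0 T P z (w, P y) <-> w = g y) ->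
  everywhere_defined setT (op_resolv z (op_QT T P)).
Proof.
move=> gE; have RE := op_resolv_QT_block g gE; split=> //.
- split; first exact: op_resolv_subspace op_QT_linear.
  by move=> w x x' /RE -> /RE ->.
- by rewrite eqEsubset; split=> // w _; eexists; apply/RE.
Qed.

Lemma op_resolv_QT_bounded (g : {linear X -> X}) : bounded_map r ->
  (forall y w, stieltjes B0 T P z (w, P y) <-> w = g y) -> bounded_map g ->
  bounded_operator setT (op_resolv z (op_QT T P)).
Proof.
move=> br gE bg; split; first exact: op_resolv_QT_everywhere gE.
suff [M RM] : bounded_map (fun w => r (g (w - r (w - P w)) + (w - P w))).
  by exists M => w x /(op_resolv_QT_block g gE) ->.
have bQ : bounded_map (fun w => w - P w).
  exact: bounded_mapB bounded_map_id bP.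
apply: (bounded_map_comp r) => //; apply: bounded_mapD => //.
apply: (bounded_map_comp g) => //; apply: bounded_mapB.
  exact: bounded_map_id.
exact: (bounded_map_comp r).
Qed.

(** If v n tends to 0 and g (v n) to y, then y is in B0, which is closed, and by
    continuity s(z) y = P (r y) is the limit 0 of P (v n); hence
    y = s(z)^-1 0 = 0, and the closed graph theorem applies to g. *)
Lemma stieltjes_inv_bounded (g : {linear X -> X}) :
  (forall x : K, exists n : nat, `|x| < n%:R) -> bounded_map r ->
  (forall y w, stieltjes B0 T P z (w, P y) <-> w = g y) -> bounded_map g.
Proof.
move=> archiK br gE; apply: (closed_graph archiK) => v y v0 gv.
have gP n : stieltjes B0 T P z (g (v n), P (v n)) by apply/gE.
have B0y : B0 y.
  case: subB0 => _ cB0; apply: (closed_cvg B0 cB0 _ y gv).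
  by apply: nearW => n; case/stieltjesE: (gP n).
rewrite -(linear0 g); apply/gE; rewrite linear0.
have /stieltjesE[_ B00 _] := gP 0%N.
have Pv := bounded_map_cvg P bP _ _ v0.
have Prgv := bounded_map_cvg P bP _ _ (bounded_map_cvg r br _ _ gv).
have eqPv : P \o (r \o (g \o v)) = P \o v.
  by apply/funext => n /=; case/stieltjesE: (gP n).
rewrite eqPv in Prgv.
have Pr0 : P 0 = P (r y) by apply: (cvg_unique (@norm_hausdorff _ _) Pv Prgv).
rewrite linear0 in Pr0; apply/stieltjesE; split=> //.
by rewrite -(linear0 P); exact: B0_P.
Qed.

Lemma first_returnE y c : first_return B0 T P z (y, c) <->
  [/\ B0 y, B0 c & exists x t,
      [/\ op_resolv z (op_QT T P) (y, x), T (x, t) & c = P t]].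
Proof.
split=> [[[t [x [u uE Rx] Tt] cE] [B0y B0c]]|[B0y B0c [x [t [Rx Tt cE]]]]].
  have {}uE : u = y by rewrite -[y](B0P y).1.
  by split=> //; exists x, t; split; rewrite -?uE.
split=> //; exists t => //; exists x => //; exists y => //.
by rewrite /op_fun/=; move/B0P: B0y.
Qed.

(** For y in B0, the solution x = r u of (1 - z QT) x = y has u = s(z)^-1 y and
    P x = y, and applying P to u = x - z T x gives u = y - z P T x. *)
Lemma stieltjes_inv_first_return : ((stieltjes B0 T P z)^-1)%relation =
  op_sub (op_id B0) (op_scale z (first_return B0 T P z)).
Proof.
case: linT => _ Tfun.
rewrite eqEsubset; split=> -[y w].
  move=> /stieltjesE/= [B0w B0y yE]; have /B0P Pw := B0w.
  have [t Tt wE] := (op_resolvE z T w (r w)).1 ((rE w (r w)).2 erefl).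
  exists y, (z *: P t); split=> //=.
    exists (P t) => //; apply/first_returnE; split=> //.
    exists (r w), t; split=> //; apply/op_resolv_QT; exists w => //.
    by rewrite Pw subrr add0r.
  by rewrite -{1}Pw {1}wE [P (_ - _)]linearB [P (_ *: _)]linearZ/= -yE.
move=> [_ [_ [[/= B0y ->]]]]
  [c /= /first_returnE[_ _ [x [t [Rx Tt ->]]]] -> ->].
have [u xE PyE] := (op_resolv_QT y x).1 Rx.
apply/stieltjesE => /=.
have [B0u yE] := block_solution y u B0y PyE; have /B0P Pu := B0u.
have /rE/op_resolvE[t' Tt' uE] := xE.
have -> : y - z *: P t = u.
  rewrite -[RHS]Pu uE [P (_ - _)]linearB [P (_ *: _)]linearZ/= xE -yE.
  by rewrite (Tfun x t t').
by split.
Qed.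

End FirstReturn.

Theorem theorem2p5 (R : realType) (B : completeNormedModType R[i])
    (T : set (B * B)) (B0 : set B) (P : {linear B -> B})
    (hT : closed_operator T) (hB0 : closed_subspace B0)
    (hP : bounded_projection B0 P) :
  (forall z : R[i], z != 0 -> z^-1 \in varrho T ->
     (z^-1 \in varpi (op_QT T P) <->
        everywhere_defined B0 ((stieltjes B0 T P z)^-1)%relation)
     /\
     (z^-1 \in varrho (op_QT T P) <->
        bounded_operator B0 ((stieltjes B0 T P z)^-1)%relation))
  /\
  (forall z : R[i], z != 0 -> z^-1 \in varrho T `&` varpi (op_QT T P) ->
     ((stieltjes B0 T P z)^-1)%relation =
       op_sub (op_id B0) (op_scale z (first_return B0 T P z))).
Proof.
have [linT _] := hT.
have resolvent z : z != 0 -> varrho T z^-1 ->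
    exists2 r : {linear B -> B}, bounded_map r &
      forall w x, op_resolv z T (w, x) <-> x = r w.
  move=> z0 /(varrho_resolv _ _ z0)[edR [M RM]].
  have [r rE] := everywhere_defined_linear _ edR.
  by exists r => //; exists M => w; apply: RM; apply/rE.
split=> z z0; last first.
  rewrite inE => -[/(resolvent _ z0)[r _ rE] _].
  exact: (stieltjes_inv_first_return _ _ _ _ linT hP r rE).
rewrite !inE => /(resolvent _ z0)[r br rE].
have linQT := op_QT_linear T P linT.
have ed_s := stieltjes_inv_everywhere _ _ _ _ linT hB0 hP r rE.
have inv_s := stieltjes_inv_linear T B0 P z hP.
have bounded_g := stieltjes_inv_bounded _ _ _ _ hB0 hP r rE _
  (@complex_archimedean R) br.
split.
  rewrite (varpi_resolv _ _ z0 linQT); split=> // /inv_s[g gE].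
  exact: (op_resolv_QT_everywhere _ _ _ _ linT hP r rE g gE).
rewrite (varrho_resolv _ _ z0); split=> [[/ed_s ed _]|[/inv_s[g gE] _]].
  split=> //; have [g gE] := inv_s ed; have [M gM] := bounded_g g gE.
  exists M => y w Sw.
  have [_ B0y _] := (stieltjesE _ _ _ _ hP r rE w y).1 Sw.
  have Py : P y = y.
    by case: hP => _ PP ranP; move: B0y; rewrite -ranP => -[x _ <-].
  have /gE -> : stieltjes B0 T P z (w, P y) by rewrite Py.
  exact: gM.
exact: (op_resolv_QT_bounded _ _ _ _ linT hP r rE g br gE (bounded_g g gE)).
Qed.
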